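(* Let $C\subset[0,1]$ be a meager subset. Then, for a residual subset of $\phi\in\mathcal{H}^{+}$, the image $\phi(C)$ is FAP (has no $3$-term APs). That is, the set $\{\phi\in\mathcal{H}^{+}\mid \phi(C)\text{ is FAP}\}$ is residual in $\mathcal{H}^{+}$.
   Context: $\mathcal{H}^{+}$ denotes the set of increasing homeomorphisms $f\colon[0,1]\to[0,1]$ (equivalently, continuous strictly increasing $f\colon[0,1]\to\mathbb{R}$ with $f(0)=0$, $f(1)=1$), viewed as a subset of the Banach space of continuous functions $f\colon[0,1]\to\mathbb{R}$ with the norm $\|f\|=\max_{x\in[0,1]}|f(x)|$, with the induced topology. A $3$-term arithmetic progression (AP) is a sequence $x,\,x+d,\,x+2d$ of real numbers with step $d>0$. A set $S\subset\mathbb{R}$ is FAP if it contains no $3$-term APs. A set is nowhere dense if its closure has empty interior, meager if it is a countable union of nowhere dense sets, and a subset of a space is residual in that space if its complement is meager in that space. *)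

(* Defs.v *)
From HB Require Import structures.
From mathcomp Require Import all_boot all_order all_algebra.
From mathcomp Require Import all_classical all_reals all_analysis.
From mathcomp Require Import lra.
Set Implicit Arguments.
Unset Strict Implicit.
Unset Printing Implicit Defensive.
Import Order.TTheory GRing.Theory Num.Theory numFieldNormedType.Exports.
Local Open Scope classical_set_scope.
Local Open Scope ring_scope.

Definition nowhere_dense (T : topologicalType) (A : set T) : Prop :=
  interior (closure A) = set0.

Definition meager (T : topologicalType) (A : set T) : Prop :=
  exists F : nat -> set T,
    (forall n, nowhere_dense (F n)) /\ A = \bigcup_n F n.

Definition residual (T : topologicalType) (A : set T) : Prop :=
  meager (~` A).

Definition FAP (R : realType) (S : set R) : Prop :=
  ~ exists x d : R, [/\ 0 < d, S x, S (x + d) & S (x + 2 * d)].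

Definition unit_itv (R : realType) : topologicalType :=
  set_type (`[0, 1]%classic : set R).

(* Increasing homeomorphisms h of [0,1], seen as real-valued functions.
   {uniform _ -> R} carries the topology of uniform convergence; Hplus_setP and
   nbhs_HplusP below show that this is the usual description by continuous
   strictly increasing functions, with the sup-norm topology. *)
Definition Hplus_set (R : realType) : set {uniform unit_itv R -> R} :=
  [set f | exists h g : unit_itv R -> unit_itv R,
     [/\ continuous h, continuous g, cancel h g & cancel g h] /\
     (forall x y : unit_itv R, \val x < \val y -> \val (h x) < \val (h y)) /\
     f = \val \o h].

Definition Hplus (R : realType) : topologicalType := set_type (@Hplus_set R).

Definition Hplus_fun (R : realType) (phi : Hplus R) : unit_itv R -> R := \val phi.

Lemma Hplus_setP (R : realType) (f : unit_itv R -> R) :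
  Hplus_set f <->
  [/\ continuous f, forall x y : unit_itv R, \val x < \val y -> f x < f y,
      forall x : unit_itv R, \val x = 0 -> f x = 0 & forall x : unit_itv R, \val x = 1 -> f x = 1].
Proof.
have I01 (x : unit_itv R) : 0 <= \val x <= 1.
  by have := set_valP x; rewrite /= in_itv.
have mI (y : R) : 0 <= y <= 1 -> y \in (`[0, 1]%classic : set R).
  by move=> y01; apply/mem_set; rewrite /= in_itv.
pose mk y (y01 : 0 <= y <= 1) : unit_itv R := SigSub (mI y y01).
split.
  move=> [h [g [[ch _ _ gK] [hinc ->]]]].
  have hle x y : \val x <= \val y -> \val (h x) <= \val (h y).
    rewrite le_eqVlt => /orP[/eqP/val_inj->//|/hinc/ltW//].
  split=> //.
  - move=> x; apply: (@continuous_comp _ _ R h \val); first exact: ch.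
    exact: (@initial_continuous _ R (\val : unit_itv R -> R)).
  - move=> x x0; apply/eqP; rewrite eq_le; apply/andP; split; last first.
      by have /andP[] := I01 (h x).
    have z0 : 0 <= (0 : R) <= 1 by rewrite lexx ler01.
    rewrite -[leRHS]/(\val (mk 0 z0)) -[X in _ <= \val X]gK; apply: hle.
    by rewrite x0; have /andP[] := I01 (g (mk 0 z0)).
  - move=> x x1; apply/eqP; rewrite eq_le; apply/andP; split.
      by have /andP[] := I01 (h x).
    have z1 : 0 <= (1 : R) <= 1 by rewrite lexx ler01.
    rewrite -[leLHS]/(\val (mk 1 z1)) -[X in \val X <= _]gK; apply: hle.
    by rewrite x1; have /andP[] := I01 (g (mk 1 z1)).
move=> [cf finc f0 f1].
have z0 : 0 <= (0 : R) <= 1 by rewrite lexx ler01.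
have z1 : 0 <= (1 : R) <= 1 by rewrite lexx ler01.
have fle x y : \val x <= \val y -> f x <= f y.
  by rewrite le_eqVlt => /orP[/eqP/val_inj->//|/finc/ltW//].
have f01 x : 0 <= f x <= 1.
  have /andP[x0 x1] := I01 x; apply/andP; split.
    by have := fle (mk 0 z0) x x0; rewrite (f0 (mk 0 z0)).
  by have := fle x (mk 1 z1) x1; rewrite (f1 (mk 1 z1)).
pose F : R -> R := valL f.
have FE (x : unit_itv R) : F (\val x) = f x.
  by have /(congr1 (fun k => k x)) := valLK point f.
have cF : {within `[0, 1], continuous F} by apply/subspace_valL_continuousP.
have F0 : F 0 = 0 by rewrite -[X in F X]/(\val (mk 0 z0)) FE f0.
have F1 : F 1 = 1 by rewrite -[X in F X]/(\val (mk 1 z1)) FE f1.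
have surj (y : unit_itv R) : exists x, f x = \val y.
  have := @IVT R F 0 1 (\val y) ler01 cF.
  rewrite F0 F1 min_l ?max_r ?ler01// => /(_ (I01 y)) [c].
  by rewrite in_itv /= => c01 Fc; exists (mk c c01); rewrite -FE.
pose g y := sval (cid (surj y)).
have fg y : f (g y) = \val y by rewrite /g; case: cid.
pose h x : unit_itv R := mk (f x) (f01 x).
have hK : cancel h g.
  move=> x; apply/val_inj; have /= E := fg (h x).
  by case: (ltgtP (\val (g (h x))) (\val x)) => // /finc; rewrite E ltxx.
have gK : cancel g h by move=> y; apply/val_inj; rewrite /= fg.
have cont (k : unit_itv R -> unit_itv R) :
    continuous (\val \o k : unit_itv R -> R) -> continuous k.
  move=> ck; apply: (@continuous_comp_initial _ _ _ _ _ ck).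
exists h, g; split; last by split.
split=> //; first exact: cont.
apply: cont.
pose G : R -> R := valL (\val \o g : unit_itv R -> R).
have GE (x : unit_itv R) : G (\val x) = \val (g x).
  by have /(congr1 (fun k => k x)) := valLK point (\val \o g : unit_itv R -> R).
suff cG : {within `[0, 1], continuous G}.
  by move=> x; have := (@subspace_valL_continuousP R `[0, 1] R _).1 cG x; apply.
have := @segment_can_le_continuous R 0 1 F G ler01 cF.
rewrite F0 F1; apply=> x; rewrite in_itv /= => x01.
by rewrite -[x]/(\val (mk x x01)) FE -[f _]/(\val (h (mk x x01))) GE hK.
Qed.

Lemma nbhs_HplusP (R : realType) (f : Hplus R) (P : set (Hplus R)) :
  let norm (u : unit_itv R -> R) := sup [set `|u x| | x in setT] in
  nbhs f P <-> exists2 e : R, 0 < e &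
    forall g : Hplus R, norm (fun x => \val f x - \val g x) < e -> P g.
Proof.
move=> norm.
have z0 : (0 : R) \in (`[0, 1]%classic : set R).
  by apply/mem_set; rewrite /= in_itv /= lexx ler01.
have bd (g h : Hplus R) (x : unit_itv R) :
    `|\val g x - \val h x| <= norm (fun x => \val g x - \val h x).
  apply: ub_le_sup; last by exists x.
  exists 2 => _ [y _ <-].
  have b01 (k : Hplus R) : `|\val k y| <= 1.
    have [k1 [k2 [_ [_ ->]]]] := set_valP k.
    have /= := set_valP (k1 y); rewrite in_itv /= => /andP[h0 h1].
    by rewrite ger0_norm.
  by rewrite (le_trans (ler_normB _ _))// -[2]/(1 + 1) lerD.
split.
  move=> [_ /= [[W oW <-] /= Wf] WP].
  have /uniform_nbhs[E [entE EW]] : nbhs (\val f) W by exact: open_nbhs_nbhs.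
  move: entE; rewrite -entourage_ballE => -[e /= e0 eE].
  exists e => // g ltge; apply: WP => /=; apply: EW => x _; apply: eE => /=.
  exact: le_lt_trans (bd f g x) ltge.
move=> [e e0 eP].
suff : nbhs (\val f) [set h : {uniform unit_itv R -> R} |
    forall x, setT x -> `|\val f x - h x| < e / 2].
  pose w : Hplus R -> {uniform unit_itv R -> R} := \val.
  have cw : continuous w by exact: initial_continuous.
  move=> nf; suff sP : w @^-1` [set h : {uniform unit_itv R -> R} |
      forall x, setT x -> `|\val f x - h x| < e / 2] `<=` P.
    exact: filterS sP (cw f _ nf).
  move=> g /= fg; apply: eP.
  apply: (@le_lt_trans _ _ (e / 2)); last by rewrite ltr_pdivrMr// ltr_pMr// ltr1n.
  apply: ge_sup; first by exists `|\val f (SigSub z0) - \val g (SigSub z0)|, (SigSub z0).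
  by move=> _ [x _ <-]; apply/ltW/fg.
apply/uniform_nbhs; exists [set xy | ball xy.1 (e / 2) xy.2]; split.
  rewrite -entourage_ballE; exists (e / 2) => //=; exact: divr_gt0.
by move=> h.
Qed.

(* For subsets of [0,1], being meager in [0,1] and being meager in R agree. *)
Lemma meager_unit_itvP (R : realType) (C : set (unit_itv R)) :
  meager C <-> meager ((\val : unit_itv R -> R) @` C).
Proof.
pose v : unit_itv R -> R := \val.
have cv : continuous v by exact: initial_continuous.
have mI (y : R) : 0 <= y <= 1 -> y \in (`[0, 1]%classic : set R).
  by move=> y01; apply/mem_set; rewrite /= in_itv.
have I01 (x : unit_itv R) : 0 <= v x <= 1.
  by have := set_valP x; rewrite /= in_itv.
have clI (A : set (unit_itv R)) : closure (v @` A) `<=` [set` `[0, 1]].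
  have /closure_id c01 : closed (`[0, 1]%classic : set R) by exact: itv_closed.
  move=> y vAy; rewrite c01; move: y vAy; apply: closureS => _ [x _ <-] /=.
  by rewrite in_itv; exact: I01.
have clE (A : set (unit_itv R)) x : closure A x <-> closure (v @` A) (v x).
  split=> [cA B /cv /cA [y [Ay By]]|cA B [_ /= [[W oW <-] /= Wx] WB]].
    by exists (v y); split=> //; exists y.
  have /cA [_ [[y Ay <-] Wy]] : nbhs (v x) W by exact: open_nbhs_nbhs.
  by exists y; split=> //; exact: WB.
have nd1 (A : set (unit_itv R)) :
    nowhere_dense A -> nowhere_dense (v @` A).
  move=> A0; rewrite /nowhere_dense -subset0 => y yA.
  have := interior_subset yA => /clI; rewrite /= in_itv => y01.
  have : interior (closure A) (SigSub (mI y y01)).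
    have yA' : nbhs (v (SigSub (mI y y01))) (closure (v @` A)) by exact: yA.
    have sub : v @^-1` closure (v @` A) `<=` closure A by move=> x /= /clE.
    exact: filterS sub (cv _ _ yA').
  by rewrite A0.
have nd2 (A : set (unit_itv R)) (B : set R) : A = v @^-1` B ->
    nowhere_dense B -> nowhere_dense A.
  move=> -> B0; rewrite /nowhere_dense -subset0 => x [_ /= [[W oW <-] /= Wx] WA].
  suff [z [Wz z01]] : exists z, W z /\ 0 < z < 1.
    have : interior (closure B) z.
      have : nbhs z (W `&` `]0, 1[%classic).
        apply: filterI; first exact: open_nbhs_nbhs.
        by apply: open_nbhs_nbhs; split; [exact: itv_open|rewrite /= in_itv].
      apply: filterS => u [Wu]; rewrite /= in_itv /= => /andP[u0 u1].
      have u01 : 0 <= u <= 1 by rewrite !ltW.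
      have /clE : closure (v @^-1` B) (SigSub (mI u u01)) by exact: WA.
      by apply: closureS => _ [w Bw <-].
    by rewrite B0.
  have /nbhs_ballP[e /= e0 eW] : nbhs (v x) W by exact: open_nbhs_nbhs.
  have /andP[x0 x1] := I01 x.
  have [d [d0 de d4]] : exists d : R, [/\ 0 < d, d < e & d <= 4^-1].
    exists (Num.min (e / 2) 4^-1); split; last by rewrite ge_min lexx orbT.
      by rewrite lt_min; apply/andP; split; lra.
    by rewrite gt_min; apply/orP; left; lra.
  have [xlt|xge] := ltP (v x) 2^-1.
    exists (v x + d); split; last by apply/andP; split; lra.
    apply: eW; rewrite /ball /= opprD addrA subrr add0r normrN ger0_norm//.
    exact: ltW.
  exists (v x - d); split; last by apply/andP; split; lra.
  apply: eW; rewrite /ball /= opprB addrCA subrr addr0 ger0_norm//.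
  exact: ltW.
split=> [[F [ndF ->]]|[F [ndF CF]]].
  exists (fun n => v @` F n); split; first by move=> n; exact: nd1.
  by rewrite image_bigcup.
exists (fun n => v @^-1` F n); split; first by move=> n; exact: nd2 (ndF n).
rewrite -preimage_bigcup -CF; apply/seteqP; split=> [x Cx|x [y Cy /val_inj <-]//].
by exists x.
Qed.

(* Main.v *)
Require Import Defs.
From mathcomp Require Import all_boot all_order all_algebra.
From mathcomp Require Import all_classical all_reals all_analysis.
From mathcomp Require Import lra ring zify.
Import Order.TTheory GRing.Theory Num.Theory numFieldNormedType.Exports.
Set Implicit Arguments.
Unset Strict Implicit.
Unset Printing Implicit Defensive.
Local Open Scope classical_set_scope.
Local Open Scope ring_scope.

(** Write C as the union of nowhere dense sets F i, and let K n be the union of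
    F 0, ..., F n, again nowhere dense. If phi(C) contains a progression
    phi x, phi y, phi z of step d > 0, then x, y, z all lie in some K n with
    d >= 1/(n+1). So it is enough that, for K nowhere dense and d > 0, the set
    of the phi for which phi(K) contains a progression of step at least d is
    nowhere dense in the space of homeomorphisms ([nowhere_dense_large_AP]).

    For this, a given phi is approximated by some psi such that psi(K) misses
    every progression of step at least d / 2 by a fixed margin mu
    ([Hplus_perturb]); the margin survives in a whole neighbourhood of psi.

    The idea is to make psi nearly finite-valued on K. Let m be large. As K is
    nowhere dense, each level set {i/m < phi < (i+1)/m} contains an interval
    that avoids K; let a monotone function T climb from i/m to (i+1)/m there and
    be constant elsewhere ([staircase]). Then |T - phi| <= 1/m, and T takes only
    values i/m on K. These values are full of progressions, but the strictly
    convex function q(u) = (1-s)u + s u^2 with s small destroys them: if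
    i + k <> 2j then q(i/m) + q(k/m) - 2q(j/m) is dominated by its linear part,
    of size at least (1-s)/m, and if i + k = 2j with i < j then strict convexity
    makes it at least 2s/m^2 ([bend_gap]). Take psi = q o ((1-t)T + t phi):
    the term t phi makes psi strictly increasing, and for t small it leaves
    half of the margin, and two points of K with the same value of T have
    psi-values closer than d / 2. *)

(** * Nowhere dense sets *)

(** In this form nowhere density passes to finite unions by shrinking open sets
    successively, and can be used and proved without handling closures. *)
Lemma nowhere_denseP (T : topologicalType) (A : set T) :
  nowhere_dense A <-> forall U : set T, open U -> U !=set0 ->
    exists V : set T, [/\ open V, V !=set0, V `<=` U & V `&` A = set0].
Proof.
split=> [A0 U oU U0|AP].
  exists (U `&` ~` closure A); split.
  - by apply: openI => //; apply: closed_openC; exact: closed_closure.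
  - apply: contrapT => /set0P/negP; rewrite negbK => /eqP UA.
    have [x Ux] := U0.
    suff : interior (closure A) x by rewrite A0.
    apply: filterS (open_nbhs_nbhs (conj oU Ux)) => y Uy.
    apply: contrapT => Ay.
    by have : (U `&` ~` closure A) y by []; rewrite UA.
  - by move=> x [].
  - rewrite -subset0 => x [[_ nA] Ax]; apply: nA; exact: subset_closure.
rewrite /nowhere_dense; apply: contrapT => /eqP/set0P A0.
have [V [oV [x Vx] VA V0]] := AP _ (open_interior _) A0.
have /(_ V (open_nbhs_nbhs (conj oV Vx))) [y [Ay Vy]] := interior_subset (VA x Vx).
by have : (V `&` A) y by []; rewrite V0.
Qed.

Lemma nowhere_denseU (T : topologicalType) (A B : set T) :
  nowhere_dense A -> nowhere_dense B -> nowhere_dense (A `|` B).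
Proof.
move=> /nowhere_denseP Ad /nowhere_denseP Bd; apply/nowhere_denseP => U oU U0.
have [V [oV V0 VU VA]] := Ad U oU U0.
have [W [oW W0 WV WB]] := Bd V oV V0.
exists W; split=> //; first exact: subset_trans VU.
rewrite setIUr WB setU0 -subset0 -VA; exact: setSI.
Qed.

Lemma nowhere_dense_bigcup (T : topologicalType) (F : nat -> set T) (n : nat) :
  (forall i, nowhere_dense (F i)) -> nowhere_dense (\bigcup_(i < n.+1) F i).
Proof.
move=> Fd; elim: n => [|n IHn]; first by rewrite bigcup_mkord big_ord1.
by rewrite bigcup_mkord big_ord_recr /= -bigcup_mkord; exact: nowhere_denseU.
Qed.

(** * The unit interval and its increasing homeomorphisms *)

Section UnitInterval.
Variable R : realType.
Implicit Types (x y : unit_itv R) (phi psi : Hplus R).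

Lemma unit_itv_ge0 x : 0 <= \val x.
Proof. by have := set_valP x; rewrite /= in_itv => /andP[]. Qed.

Lemma unit_itv_le1 x : \val x <= 1.
Proof. by have := set_valP x; rewrite /= in_itv => /andP[]. Qed.

Lemma unit_itv_exists (t : R) : 0 <= t <= 1 -> exists x, \val x = t.
Proof.
move=> t01; have tI : t \in (`[0, 1]%classic : set R).
  by apply/mem_set; rewrite /= in_itv.
by exists (SigSub tI).
Qed.

Lemma continuous_unit_itv_val : continuous (\val : unit_itv R -> R).
Proof. exact: initial_continuous. Qed.

Lemma Hplus_fun_mono phi x y :
  \val x <= \val y -> Hplus_fun phi x <= Hplus_fun phi y.
Proof.
have /Hplus_setP[_ phi_inc _ _] := set_valP phi.
by rewrite le_eqVlt => /orP[/eqP/val_inj->//|/phi_inc/ltW].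
Qed.

Lemma Hplus_fun_itv phi x : 0 <= Hplus_fun phi x <= 1.
Proof.
have [h [g [_ [_ E]]]] := set_valP phi.
by rewrite /Hplus_fun E /= unit_itv_ge0 unit_itv_le1.
Qed.

Lemma Hplus_fun_surj phi (t : R) : 0 <= t <= 1 -> exists x, Hplus_fun phi x = t.
Proof.
have [h [g [[_ _ _ gK] [_ E]]]] := set_valP phi.
move=> /unit_itv_exists[y <-]; exists (g y).
by rewrite /Hplus_fun E /= gK.
Qed.

Lemma nbhs_Hplus_ball phi (e : R) : 0 < e ->
  nbhs phi [set psi | forall x, `|Hplus_fun phi x - Hplus_fun psi x| < e].
Proof.
move=> e0; apply/nbhs_HplusP; exists e => // psi lte x; apply: le_lt_trans lte.
apply: ub_le_sup; last by exists x.
exists 1 => _ [y _ <-].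
have := Hplus_fun_itv phi y; have := Hplus_fun_itv psi y.
by rewrite /Hplus_fun ler_norml; lra.
Qed.

Lemma nbhs_Hplus_sub phi (P : set (Hplus R)) : nbhs phi P ->
  exists2 e : R, 0 < e &
    forall psi, (forall x, `|Hplus_fun phi x - Hplus_fun psi x| <= e) -> P psi.
Proof.
move=> /nbhs_HplusP[e e0 eP]; exists (e / 2); first exact: divr_gt0.
move=> psi near; apply: eP; apply: (@le_lt_trans _ _ (e / 2)); last by lra.
have [z _] : exists z : unit_itv R, \val z = 0.
  by apply: unit_itv_exists; rewrite lexx ler01.
apply: ge_sup; last by move=> _ [x _ <-]; exact: near.
by exists `|\val phi z - \val psi z|, z.
Qed.

(** A place for a riser: the levels strictly between u and v form a nonempty open
    set of points, which contains an interval that avoids K. *)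
Lemma nowhere_dense_gap phi (K : set (unit_itv R)) (u v : R) :
  nowhere_dense K -> 0 <= u -> u < v -> v <= 1 ->
  exists a b : unit_itv R,
    [/\ \val a < \val b, u <= Hplus_fun phi a, Hplus_fun phi b <= v &
        forall x, K x -> \val x <= \val a \/ \val b <= \val x].
Proof.
move=> /nowhere_denseP Kd u0 uv v1.
have /Hplus_setP[cphi _ _ _] := set_valP phi.
pose U := Hplus_fun phi @^-1` `]u, v[.
have oU : open U by apply: open_comp (itv_open u v) => x _; exact: cphi.
have U0 : U !=set0.
  have [x xE] : exists x, Hplus_fun phi x = (u + v) / 2.
    by apply: Hplus_fun_surj; lra.
  by exists x; rewrite /U /= in_itv /= xE; lra.
have [V [[W oW WV] [a Va] VU VK]] := Kd U oU U0.
have /nbhs_ballP[e /= e0 eW] : nbhs (\val a) W.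
  by apply: open_nbhs_nbhs; split=> //; move: Va; rewrite -WV.
have a0 := unit_itv_ge0 a.
have /VU := Va; rewrite /U /= in_itv /= => /andP[ua av].
have a1 : \val a < 1.
  rewrite lt_neqAle unit_itv_le1 andbT; apply/eqP => a1.
  have /Hplus_setP[_ _ _ /(_ a a1)] := set_valP phi.
  by rewrite -/(Hplus_fun phi a); lra.
have [b bE] : exists b : unit_itv R, \val b = Num.min (\val a + e / 2) 1.
  apply: unit_itv_exists; rewrite ge_min lexx orbT le_min ler01.
  by rewrite addr_ge0// divr_ge0// ltW.
have inV x : \val a <= \val x <= \val b -> V x.
  move=> /andP[ax]; rewrite bE le_min => /andP[xe _].
  rewrite -WV; apply: eW; rewrite /ball /= distrC ger0_norm ?subr_ge0// ltrBlDl.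
  by apply: le_lt_trans xe _; rewrite ltrD2l; lra.
have ab : \val a < \val b by rewrite bE lt_min a1 andbT; lra.
exists a, b; split=> //; first exact: ltW.
  have /inV/VU : \val a <= \val b <= \val b by rewrite lexx ltW.
  by rewrite /U /= in_itv /= => /andP[_ /ltW].
move=> x Kx; case: (leP (\val x) (\val a)) => [|ax]; first by left.
case: (leP (\val b) (\val x)) => [|xb]; first by right.
suff : (V `&` K) x by rewrite VK.
by split=> //; apply: inV; rewrite !ltW.
Qed.

(** * Staircases that are finite-valued on a nowhere dense set *)

Definition ramp (a b t : R) : R := Num.max 0 (Num.min 1 ((t - a) / (b - a))).

Lemma ramp_continuous (a b : R) : continuous (ramp a b).
Proof.
move=> t; apply: (@continuous_max _ R (cst 0) (fun t => Num.min 1 ((t - a) / (b - a)))).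
  exact: cst_continuous.
apply: (@continuous_min _ R (cst 1) (fun t => (t - a) / (b - a))).
  exact: cst_continuous.
apply: cvgMr_tmp; apply: cvgB; [exact: cvg_id|exact: cvg_cst].
Qed.

Lemma ramp_itv (a b t : R) : 0 <= ramp a b t <= 1.
Proof. by rewrite /ramp le_max lexx ge_max ler01 ge_min lexx. Qed.

Lemma ramp_left (a b t : R) : a < b -> t <= a -> ramp a b t = 0.
Proof.
move=> ab ta; apply: max_l; rewrite ge_min; apply/orP; right.
by apply: mulr_le0_ge0; rewrite ?invr_ge0; lra.
Qed.

Lemma ramp_right (a b t : R) : a < b -> b <= t -> ramp a b t = 1.
Proof.
move=> ab bt; rewrite /ramp min_l ?max_r ?ler01//.
by rewrite ler_pdivlMr; lra.
Qed.

Lemma ramp_mono (a b s t : R) : a < b -> s <= t -> ramp a b s <= ramp a b t.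
Proof.
move=> ab st; have d0 : 0 <= (b - a)^-1 by rewrite invr_ge0; lra.
apply: le_max2 => //; apply: le_min2 => //; apply: ler_wpM2r => //; lra.
Qed.

(** By induction on the number M of risers, each placed in a gap of K and climbing
    by 1. Only the case M = m is of interest, where S / m is within 1 / m of phi;
    the last two clauses are what the induction needs: once m * phi has passed
    the level M all the risers have been climbed, and before that S is ahead or
    behind by at most one riser. *)
Lemma staircase phi (K : set (unit_itv R)) (m M : nat) :
  nowhere_dense K -> (M <= m)%N ->
  exists S : unit_itv R -> R,
  [/\ continuous S, forall x y, \val x <= \val y -> S x <= S y,
      forall x, K x -> exists2 i : nat, (i <= M)%N & S x = i%:R,
      forall x, M%:R <= m%:R * Hplus_fun phi x -> S x = M%:R &
      forall x, m%:R * Hplus_fun phi x <= M%:R ->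
        `|S x - m%:R * Hplus_fun phi x| <= 1 /\
        (Hplus_fun phi x = 0 -> S x = 0)].
Proof.
move=> Kd; elim: M => [_|M IHM Mm].
  exists (cst 0); split=> //; first by move=> x; exact: cst_continuous.
    by move=> x _; exists 0%N.
  move=> x; have /andP[phi0 _] := Hplus_fun_itv phi x => xM.
  have -> : m%:R * Hplus_fun phi x = 0.
    by apply/eqP; rewrite eq_le xM mulr_ge0.
  by rewrite subrr normr0 ler01.
have [S [cS Smono SK Sright Sleft]] := IHM (ltnW Mm).
have m0 : 0 < m%:R :> R by rewrite ltr0n (leq_trans _ Mm).
have [a [b [ab aM bM abK]]] : exists a b : unit_itv R,
    [/\ \val a < \val b, M%:R <= m%:R * Hplus_fun phi a,
        m%:R * Hplus_fun phi b <= M.+1%:R &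
        forall x, K x -> \val x <= \val a \/ \val b <= \val x].
  have [|||a [b [ab aM bM abK]]] :=
      nowhere_dense_gap phi (u := M%:R / m%:R) (v := M.+1%:R / m%:R) Kd.
  - exact: divr_ge0.
  - by rewrite ltr_pM2r ?invr_gt0// ltr_nat.
  - by rewrite ler_pdivrMr// mul1r ler_nat.
  exists a, b; split=> //; first by rewrite mulrC -ler_pdivrMr.
  by rewrite mulrC -ler_pdivlMr.
have rampl x : m%:R * Hplus_fun phi x <= M%:R -> ramp (\val a) (\val b) (\val x) = 0.
  move=> xM; apply: ramp_left => //; rewrite leNgt; apply/negP => ax.
  have /Hplus_setP[_ phi_inc _ _] := set_valP phi.
  have := phi_inc _ _ ax; rewrite -(ltr_pM2l m0) -!/(Hplus_fun phi _); lra.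
have rampr x : M.+1%:R <= m%:R * Hplus_fun phi x ->
    ramp (\val a) (\val b) (\val x) = 1.
  move=> xM; apply: ramp_right => //; rewrite leNgt; apply/negP => xb.
  have /Hplus_setP[_ phi_inc _ _] := set_valP phi.
  have := phi_inc _ _ xb; rewrite -(ltr_pM2l m0) -!/(Hplus_fun phi _); lra.
exists (fun x => S x + ramp (\val a) (\val b) (\val x)); split.
- move=> x; apply: (@continuousD _ R^o _ S (ramp (\val a) (\val b) \o \val)).
    exact: cS.
  apply: (@continuous_comp _ _ _ (\val : unit_itv R -> R) (ramp (\val a) (\val b))).
    exact: continuous_unit_itv_val.
  exact: ramp_continuous.
- by move=> x y xy; rewrite lerD ?Smono ?ramp_mono.
- move=> x Kx; have [i iM ->] := SK x Kx; have [xa|bx] := abK x Kx.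
    by exists i; [exact: leqW|rewrite ramp_left// addr0].
  by exists i.+1; rewrite // ramp_right// -natr1.
- move=> x xM; rewrite rampr// Sright -?natr1//.
  by apply: le_trans xM; rewrite ler_nat.
- move=> x xM; case: (leP (m%:R * Hplus_fun phi x) M%:R) => [xM'|Mx].
    by rewrite rampl// addr0; exact: Sleft.
  have /andP[r0 r1] := ramp_itv (\val a) (\val b) (\val x).
  rewrite (Sright x (ltW Mx)); split.
    by move: xM; rewrite -natr1 ler_norml; lra.
  by move=> x0; move: Mx; rewrite x0 mulr0 ltNge ler0n.
Qed.

(** * Destroying the progressions among the multiples of 1/m *)

(** A convex perturbation of the identity that fixes 0 and 1. *)
Definition bend (s u : R) : R := (1 - s) * u + s * u ^+ 2.

(** With N the integer i + k - 2j, the second difference is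
    (1 - s) N / m + s (i^2 + k^2 - 2j^2) / m^2. If N = 0 then i and k are
    symmetric around j, and i^2 + k^2 - 2j^2 = 2(j - i)^2. Otherwise the first
    term wins: s = 1 / (8m) bounds the second one by 1 / (8m). *)
Lemma bend_gap (m i j k : nat) (s : R) :
  (i < j)%N -> (j <= k)%N -> (k <= m)%N -> s = (8 * m%:R)^-1 ->
  s / m%:R ^+ 2 <=
  `|bend s (i%:R / m%:R) + bend s (k%:R / m%:R) - 2 * bend s (j%:R / m%:R)|.
Proof.
move=> ij jk km sE.
have m0 : 0 < m%:R :> R by rewrite ltr0n; lia.
have m1 : 1 <= m%:R :> R by rewrite ler1n; lia.
have -> : bend s (i%:R / m%:R) + bend s (k%:R / m%:R) - 2 * bend s (j%:R / m%:R)
  = ((1 - s) * (i%:R + k%:R - 2 * j%:R) * m%:R +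
     s * (i%:R ^+ 2 + k%:R ^+ 2 - 2 * j%:R ^+ 2)) / m%:R ^+ 2.
  by rewrite /bend; field; lra.
rewrite normrM [`|_^-1|]ger0_norm ?invr_ge0 ?sqr_ge0//.
rewrite ler_pM2r ?invr_gt0 ?exprn_gt0//.
have s0 : 0 < s by rewrite sE invr_gt0; lra.
have sm : s * m%:R = 8^-1 by rewrite sE; field; lra.
have s8 : s <= 8^-1 by nra.
have i0 : 0 <= i%:R :> R by [].
have ij' : i%:R + 1 <= j%:R :> R by rewrite natr1 ler_nat.
have jk' : j%:R <= k%:R :> R by rewrite ler_nat.
have km' : k%:R <= m%:R :> R by rewrite ler_nat.
have [E|[L|L]] : (i + k = 2 * j \/ i + k + 1 <= 2 * j \/ 2 * j + 1 <= i + k)%N by lia.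
- have kE : k%:R = 2 * j%:R - i%:R :> R.
    by have := congr1 (fun n => n%:R : R) E; rewrite natrD natrM; lra.
  rewrite kE (_ : i%:R + (2 * j%:R - i%:R) - 2 * j%:R = 0 :> R); last by ring.
  rewrite mulr0 mul0r add0r ger0_norm; last by apply: mulr_ge0; [lra|nra].
  by apply: ler_peMr; [lra|nra].
- have D : i%:R + k%:R + 1 <= 2 * j%:R :> R by move: L; rewrite -(ler_nat R) natrM !natrD.
  have Dm : (1 - s) * (i%:R + k%:R - 2 * j%:R) * m%:R <= - ((1 - s) * m%:R).
    have : 0 <= (1 - s) * m%:R by apply: mulr_ge0; lra.
    nra.
  have Q : s * (i%:R ^+ 2 + k%:R ^+ 2 - 2 * j%:R ^+ 2) <= s * m%:R ^+ 2.
    by rewrite ler_pM2l//; nra.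
  rewrite ler0_norm; last by nra.
  by nra.
- have D : 2 * j%:R + 1 <= i%:R + k%:R :> R.
    by move: L; rewrite -(ler_nat R) natrD natrM natrD.
  have Dm : (1 - s) * m%:R <= (1 - s) * (i%:R + k%:R - 2 * j%:R) * m%:R.
    have : 0 <= (1 - s) * m%:R by apply: mulr_ge0; lra.
    nra.
  have Q : - (s * m%:R ^+ 2) <= s * (i%:R ^+ 2 + k%:R ^+ 2 - 2 * j%:R ^+ 2).
    by rewrite -mulrN ler_pM2l//; nra.
  rewrite ger0_norm; last by nra.
  by nra.
Qed.

Lemma bendB (s u v : R) :
  bend s u - bend s v = (1 - s + s * (u + v)) * (u - v).
Proof. by rewrite /bend; ring. Qed.

Lemma bend_lipschitz (s u v : R) : 0 <= s <= 1 -> 0 <= u <= 1 -> 0 <= v <= 1 ->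
  `|bend s u - bend s v| <= 2 * `|u - v|.
Proof.
move=> s01 u01 v01.
have p0 : 0 <= s * (u + v) by apply: mulr_ge0; lra.
have p1 : s * (u + v) <= s * 2 by apply: ler_wpM2l; lra.
by rewrite bendB normrM ler_wpM2r// ger0_norm; lra.
Qed.

Lemma bend_increasing (s u v : R) : 0 <= s < 1 -> 0 <= u -> u < v ->
  bend s u < bend s v.
Proof.
move=> s01 u0 uv; rewrite -subr_gt0 bendB.
have p0 : 0 <= s * (v + u) by apply: mulr_ge0; lra.
by apply: mulr_gt0; lra.
Qed.

Lemma bend_near (s u : R) : 0 <= s -> 0 <= u <= 1 -> `|bend s u - u| <= s.
Proof.
move=> s0 u01; have -> : bend s u - u = - (s * (u * (1 - u))).
  by rewrite /bend; ring.
have p0 : 0 <= u * (1 - u) by apply: mulr_ge0; lra.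
rewrite normrN ger0_norm; last exact: mulr_ge0.
by apply: ler_piMr => //; nra.
Qed.

Lemma bend_continuous (s : R) : continuous (bend s).
Proof.
move=> u; apply: (@continuousD _ R^o _ (fun u => (1 - s) * u) (fun u => s * u ^+ 2)).
  by apply: cvgMl_tmp; exact: cvg_id.
by apply: cvgMl_tmp; exact: exprn_continuous.
Qed.

(** * Nowhere density of the set of homeomorphisms with a long progression *)

(** psi is the bent staircase, made strictly increasing by a small multiple of
    phi. For mu to survive in a neighbourhood of psi, the conclusion is
    stated for all triples of which the first two terms are d apart, not just
    for progressions. *)
Lemma Hplus_perturb phi (K : set (unit_itv R)) (e d : R) :
  nowhere_dense K -> 0 < e -> 0 < d ->
  exists2 psi, forall x, `|Hplus_fun phi x - Hplus_fun psi x| <= e &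
  exists2 mu : R, 0 < mu & forall x y z, K x -> K y -> K z ->
    Hplus_fun psi x + d <= Hplus_fun psi y -> Hplus_fun psi y <= Hplus_fun psi z ->
    mu <= `|Hplus_fun psi x + Hplus_fun psi z - 2 * Hplus_fun psi y|.
Proof.
move=> Kd e0 d0.
pose m := (Num.truncn (2 / e)).+1.
have m0 : 0 < m%:R :> R by rewrite ltr0n.
have m1 : 1 <= m%:R :> R by rewrite ler1n.
have em : 2 / m%:R <= e.
  by rewrite ler_pdivrMr// mulrC -ler_pdivrMr// ltW// truncnS_gt.
have [S [cS Smono SK Sright Sleft]] := staircase phi Kd (leqnn m).
have /Hplus_setP[cphi phi_inc phi0 phi1] := set_valP phi.
pose T x := S x / m%:R.
have cT : continuous T by move=> x; exact: cvgMr_tmp (cS x).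
have Tmono x y : \val x <= \val y -> T x <= T y.
  by move=> xy; rewrite ler_pM2r ?invr_gt0// Smono.
have mphi x : m%:R * Hplus_fun phi x <= m%:R.
  by have /andP[_ h] := Hplus_fun_itv phi x; rewrite ger_pMr.
have T0 x : \val x = 0 -> T x = 0.
  by move=> /phi0 x0; rewrite /T (Sleft x (mphi x)).2 ?mul0r.
have T1 x : \val x = 1 -> T x = 1.
  move=> /phi1 x1; rewrite /T Sright ?divff ?gt_eqF//.
  by rewrite /Hplus_fun x1 mulr1.
have T01 x : 0 <= T x <= 1.
  have [z zE] : exists z : unit_itv R, \val z = 0 by apply: unit_itv_exists; lra.
  have [w wE] : exists w : unit_itv R, \val w = 1 by apply: unit_itv_exists; lra.
  rewrite -[X in X <= T x](T0 z zE) -[X in _ && (_ <= X)](T1 w wE).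
  by rewrite !Tmono// ?zE ?wE ?unit_itv_ge0 ?unit_itv_le1.
have Tphi x : `|T x - Hplus_fun phi x| <= 1 / m%:R.
  have -> : T x - Hplus_fun phi x = (S x - m%:R * Hplus_fun phi x) / m%:R.
    by rewrite /T; field; lra.
  rewrite normrM [`|_^-1|]ger0_norm ?invr_ge0 ?(ltW m0)//.
  by rewrite ler_pM2r ?invr_gt0// (Sleft x (mphi x)).1.
pose s : R := (8 * m%:R)^-1.
have sm : s * m%:R = 8^-1 by rewrite /s; field; lra.
have s0 : 0 < s by rewrite invr_gt0; lra.
have s1 : s <= 1 / m%:R by rewrite ler_pdivlMr//; lra.
have s8 : s <= 8^-1 by nra.
pose mu := s / m%:R ^+ 2.
have mu0 : 0 < mu by rewrite divr_gt0 ?exprn_gt0.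
have mu8 : mu <= 8^-1.
  by rewrite /mu ler_pdivrMr ?exprn_gt0//; nra.
(* psi is within 2t of the bent staircase: t <= mu / 16 costs at most 8t <= mu / 2
   in a second difference, and t <= d / 8 makes 4t < d, so that two points
   that are d apart under psi lie on different steps. *)
pose t := Num.min (mu / 16) (d / 8).
have t0 : 0 < t by rewrite lt_min; apply/andP; split; lra.
have tmu : t <= mu / 16 by rewrite ge_min lexx.
have td : t <= d / 8 by rewrite ge_min lexx orbT.
pose sigma x := (1 - t) * T x + t * Hplus_fun phi x.
have sigma01 x : 0 <= sigma x <= 1.
  by have := T01 x; have := Hplus_fun_itv phi x; rewrite /sigma; nra.
have sigmaT x : `|sigma x - T x| <= t.
  have -> : sigma x - T x = t * (Hplus_fun phi x - T x) by rewrite /sigma; ring.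
  have := T01 x; have := Hplus_fun_itv phi x => phi01 T01x.
  by rewrite normrM ger0_norm ?(ltW t0)// ger_pMr// ler_norml; lra.
have sigmaphi x : `|sigma x - Hplus_fun phi x| <= 1 / m%:R.
  have -> : sigma x - Hplus_fun phi x = (1 - t) * (T x - Hplus_fun phi x).
    by rewrite /sigma; ring.
  apply: le_trans (Tphi x); rewrite normrM ler_piMl// ger0_norm; lra.
pose f x := bend s (sigma x).
have Hf : Hplus_set f.
  apply/Hplus_setP; split.
  - move=> x; apply: (@continuous_comp _ _ _ sigma (bend s)); last exact: bend_continuous.
    apply: (@continuousD _ R^o _ (fun x => (1 - t) * T x) (fun x => t * Hplus_fun phi x)).
      exact: cvgMl_tmp (cT x).
    exact: cvgMl_tmp (cphi x).
  - move=> x y xy; apply: bend_increasing; first by lra.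
      by have /andP[] := sigma01 x.
    have := Tmono x y (ltW xy); have := phi_inc x y xy.
    by rewrite /sigma -!/(Hplus_fun phi _); nra.
  - move=> x x0; rewrite /f /sigma T0// /Hplus_fun phi0// /bend; ring.
  - move=> x x1; rewrite /f /sigma T1// /Hplus_fun phi1// /bend; ring.
pose psi : Hplus R := SigSub (mem_set Hf).
have psiE x : Hplus_fun psi x = bend s (sigma x) by [].
have psiT x : `|Hplus_fun psi x - bend s (T x)| <= 2 * t.
  rewrite psiE; apply: le_trans (_ : 2 * `|sigma x - T x| <= _).
    by apply: bend_lipschitz => //; lra.
  by rewrite ler_pM2l.
exists psi.
  move=> x; have := bend_near (ltW s0) (sigma01 x).
  have := sigmaphi x; rewrite psiE !ler_norml; lra.
exists (mu / 2); first by lra.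
move=> x y z Kx Ky Kz xy yz.
have mono (x' y' : unit_itv R) : Hplus_fun psi x' <= Hplus_fun psi y' -> T x' <= T y'.
  move=> xy'; apply: Tmono; rewrite leNgt; apply/negP => yx.
  have /Hplus_setP[_ /(_ _ _ yx) psi_inc _ _] := set_valP psi.
  by move: xy'; rewrite leNgt psi_inc.
have Txy : T x <= T y by apply: mono; lra.
have Tyz := mono _ _ yz.
have [i im SxE] := SK x Kx; have [j jm SyE] := SK y Ky; have [k km SzE] := SK z Kz.
have leT (a b : nat) : (a%:R / m%:R <= b%:R / m%:R :> R) = (a <= b)%N.
  by rewrite ler_pM2r ?invr_gt0// ler_nat.
have := psiT x; have := psiT y; have := psiT z.
move: Txy Tyz; rewrite /T SxE SyE SzE !leT => ij jk.
have gap ij' := bend_gap (i := i) ij' jk km erefl.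
rewrite !ler_norml => psiz psiy psix.
have {}ij : (i < j)%N.
  by rewrite ltn_neqAle ij andbT; apply/eqP => E; move: psix psiy; rewrite E; lra.
have := gap ij; rewrite -/s -/mu !ler_normr; lra.
Qed.

End UnitInterval.

Definition large_AP_set (R : realType) (K : set (unit_itv R)) (d : R) :
    set (Hplus R) :=
  [set phi | exists x y z : unit_itv R, [/\ K x, K y & K z] /\
    d <= Hplus_fun phi y - Hplus_fun phi x /\
    Hplus_fun phi z - Hplus_fun phi y = Hplus_fun phi y - Hplus_fun phi x].

(** Bounding the step from below makes avoiding progressions stable under small
    perturbations of the homeomorphism: three points close to each other could
    otherwise be put in progression by an arbitrarily small change. *)
Lemma nowhere_dense_large_AP (R : realType) (K : set (unit_itv R)) (d : R) :
  nowhere_dense K -> 0 < d -> nowhere_dense (large_AP_set K d).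
Proof.
move=> Kd d0; apply/nowhere_denseP => U oU [phi Uphi].
have [e e0 eU] := nbhs_Hplus_sub (open_nbhs_nbhs (conj oU Uphi)).
have d2 : 0 < d / 2 by lra.
have [psi /eU Upsi [mu mu0 muP]] := Hplus_perturb phi Kd e0 d2.
(* A second difference moves by less than 4r <= mu, a first difference by less
   than 2r <= d / 4, inside the ball of radius r. *)
pose r := Num.min (mu / 4) (d / 8).
have r0 : 0 < r by rewrite lt_min; apply/andP; split; lra.
have rmu : r <= mu / 4 by rewrite ge_min lexx.
have rd : r <= d / 8 by rewrite ge_min lexx orbT.
pose B := [set chi : Hplus R | forall x, `|Hplus_fun psi x - Hplus_fun chi x| < r].
exists (U `&` interior B); split.
- by apply: openI => //; exact: open_interior.
- by exists psi; split=> //; exact: nbhs_Hplus_ball.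
- by move=> chi [].
rewrite -subset0 => chi [[_ /interior_subset chiB] [x [y [z [[Kx Ky Kz] [dxy zyx]]]]]].
have := chiB x; have := chiB y; have := chiB z; have := muP x y z Kx Ky Kz.
rewrite !ltr_norml => gap Bz By Bx.
suff : mu <= `|Hplus_fun psi x + Hplus_fun psi z - 2 * Hplus_fun psi y|.
  by rewrite ler_normr; lra.
by apply: gap; lra.
Qed.

(** * The residual set *)

Theorem proposition3 (R : realType) (C : set (unit_itv R)) (hC : meager C) :
  residual [set phi : Hplus R | FAP (Hplus_fun phi @` C)].
Proof.
have [F [Fd ->]] := hC.
exists (fun n => large_AP_set (\bigcup_(i < n.+1) F i) n.+1%:R^-1); split.
  by move=> n; apply: nowhere_dense_large_AP => //; exact: nowhere_dense_bigcup.
apply/seteqP; split.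
  move=> phi /contrapT[u [d [d0 [x [i _ Fx] xE]]]].
  move=> [y [j _ Fy] yE] [z [k _ Fz] zE].
  (* n + 1 exceeds 1 / d as well as the indices of the three pieces. *)
  pose n := maxn (Num.truncn d^-1) (maxn i (maxn j k)).
  exists n => //; exists x, y, z; split; last first.
    split; last by rewrite xE yE zE; ring.
    rewrite xE yE addrAC subrr add0r invf_ple ?posrE// ltW//.
    apply: lt_le_trans (truncnS_gt _) _.
    by rewrite ler_nat ltnS leq_maxl.
  by split; [exists i|exists j|exists k] => //=; rewrite /n; lia.
move=> phi [n _ [x [y [z [[[i _ Fx] [j _ Fy] [k _ Fz]] [dxy zyx]]]]]] /= fap.
apply: fap; exists (Hplus_fun phi x), (Hplus_fun phi y - Hplus_fun phi x).
split; first by apply: lt_le_trans dxy; rewrite invr_gt0.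
- by exists x => //; exists i.
- by exists y; [exists j|ring].
- by exists z; [exists k|lra].
Qed.
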